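(* Let $A\in\mathbb{R}^{n\times n}$ be an irreducible nonsingular $M$-matrix, let $\mathbf{a}\in\mathbb{R}^n$, $\Gamma\in\mathbb{R}$, and let the sequence $\{\lambda_k\}$ be generated by the Newton-Noda iteration (described in the context). If $\mathbf{a}>0$ and $\Gamma>0$, then the nonlinear algebraic eigenvalue problem $$A\mathbf{u}+\Gamma\,\mathrm{diag}\Big(\mathbf{e}-\frac{\mathbf{e}}{\mathbf{a}+\mathbf{u}^{[2]}}\Big)\mathbf{u}=\lambda\mathbf{u},\qquad \mathbf{u}^T\mathbf{u}=1,$$ has a positive eigenvector; that is, there exist $\lambda\in\mathbb{R}$ and $\mathbf{u}\in\mathbb{R}^n$ with $\mathbf{u}>0$ satisfying it.
   Context: Inequalities between vectors or matrices are entrywise; $\|\cdot\|$ is the 2-norm; $\mathbf{v}^{[m]}$ denotes the entrywise power and quotients of vectors are entrywise; $\mathbf{e}=[1,\dots,1]^T$; $\min(\mathbf{v})=\min_i v_i$ and $\min(\mathbf{w}/\mathbf{v})=\min_i w_i/v_i$. A $Z$-matrix is a real square matrix with nonpositive off-diagonal entries; an $M$-matrix is a (nonsingular) $Z$-matrix $A$ with $A^{-1}\ge 0$. $A$ is irreducible if there is no nonempty proper subset $S\subset\{1,\dots,n\}$ with $A_{ij}=0$ for all $i\in S$, $j\notin S$. For $\mathbf{u}\in\mathbb{R}^n$, $\lambda\in\mathbb{R}$ put $$\mathcal{A}(\mathbf{u})=A+\Gamma\,\mathrm{diag}\Big(\mathbf{e}-\frac{\mathbf{e}}{\mathbf{a}+\mathbf{u}^{[2]}}\Big),\quad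 \mathbf{r}(\mathbf{u},\lambda)=\mathcal{A}(\mathbf{u})\mathbf{u}-\lambda\mathbf{u},$$ $$J(\mathbf{u},\lambda)=A+(\Gamma-\lambda)I-\Gamma\,\mathrm{diag}\Big(\frac{\mathbf{a}-\mathbf{u}^{[2]}}{(\mathbf{a}+\mathbf{u}^{[2]})^{[2]}}\Big).$$ Newton-Noda iteration (run without a stopping test): given $\mathbf{u}_0>0$ with $\|\mathbf{u}_0\|=1$, set $\lambda_0=\min\big(\mathcal{A}(\mathbf{u}_0)\mathbf{u}_0/\mathbf{u}_0\big)$. For $k=0,1,2,\dots$: let $(\Delta_k,\delta_k)\in\mathbb{R}^n\times\mathbb{R}$ be the (unique) solution of $$\begin{bmatrix}J(\mathbf{u}_k,\lambda_k)&-\mathbf{u}_k\\-\mathbf{u}_k^T&0\end{bmatrix}\begin{bmatrix}\Delta_k\\ \delta_k\end{bmatrix}=-\begin{bmatrix}\mathbf{r}(\mathbf{u}_k,\lambda_k)\\ \tfrac12(1-\mathbf{u}_k^T\mathbf{u}_k)\end{bmatrix};$$ choose $\theta_k\in(0,1]$ by the rule below; set $\mathbf{w}_{k+1}=\mathbf{u}_k+\theta_k\Delta_k$, $\mathbf{u}_{k+1}=\mathbf{w}_{k+1}/\|\mathbf{w}_{k+1}\|$, $\lambda_{k+1}=\min\big(\mathcal{A}(\mathbf{u}_{k+1})\mathbf{u}_{k+1}/\mathbf{u}_{k+1}\big)$. Rule for $\theta_k$: for $\theta\in(0,1]$ set $\mathbf{w}_k(\theta)=\mathbf{u}_k+\theta\Delta_k$,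 $\mathbf{h}_k(\theta)=\mathbf{r}\big(\mathbf{w}_k(\theta)/\|\mathbf{w}_k(\theta)\|,\lambda_k\big)$ and $\mathbf{R}_k(\theta)=\mathbf{h}_k(\theta)-\frac{1-\theta}{\|\mathbf{w}_k(\theta)\|}\mathbf{r}(\mathbf{u}_k,\lambda_k)-\frac{\theta\delta_k}{\|\mathbf{w}_k(\theta)\|}\mathbf{u}_k$. $\eta>0$ is a fixed constant, and $M>0$ is a fixed constant such that $\|\mathbf{R}_k(\theta)\|\le M\theta^2\|\Delta_k\|^2$ for every unit vector $\mathbf{u}_k>0$ (with $\lambda_k=\min(\mathcal{A}(\mathbf{u}_k)\mathbf{u}_k/\mathbf{u}_k)$) and every $\theta\in(0,1]$. Then $\theta_k=1$ if $\mathbf{h}_k(1)\ge\frac{\delta_k\mathbf{u}_k}{(1+\eta)\|\mathbf{w}_k(1)\|}$, and otherwise $\theta_k=\eta_k:=\frac{\eta\,\delta_k\min(\mathbf{u}_k)}{(1+\eta)M\|\mathbf{w}_k(1)\|\|\Delta_k\|^2}$. *)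

(* Defs.v *)
From mathcomp Require Import all_boot all_order all_algebra.
From mathcomp Require Import reals.

Set Implicit Arguments.
Unset Strict Implicit.
Unset Printing Implicit Defensive.

Import Order.TTheory GRing.Theory Num.Theory.
Local Open Scope ring_scope.

Section Vectors.
Variable R : realType.

Definition mx_le m n (A B : 'M[R]_(m, n)) : bool :=
  [forall i, forall j, A i j <= B i j].

Definition mx_lt m n (A B : 'M[R]_(m, n)) : bool :=
  [forall i, forall j, A i j < B i j].

(* The 2-norm; the library norm on matrices is the sup norm. *)
Definition norm2 n (v : 'cV[R]_n) : R := Num.sqrt (\sum_i v i 0 ^+ 2).

Definition vpow n (v : 'cV[R]_n) (m : nat) : 'cV[R]_n :=
  map_mx (fun x => x ^+ m) v.

Definition vdiv n (v w : 'cV[R]_n) : 'cV[R]_n := map2_mx (fun x y => x / y) v w.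

Definition ones n : 'cV[R]_n := const_mx 1.

(* [diag_mx] expects a row vector. *)
Definition diag n (v : 'cV[R]_n) : 'M[R]_n := diag_mx v^T.

Definition vmin n (v : 'cV[R]_n.+1) : R := \big[Num.min/v 0 0]_i v i 0.

End Vectors.

Arguments ones {R n}.

Section Matrices.
Variables (R : realType) (n : nat).
Implicit Type A : 'M[R]_n.

Definition Zmatrix A : Prop := forall i j, i != j -> A i j <= 0.

Definition nonsingular_Mmatrix A : Prop :=
  [/\ Zmatrix A, A \in unitmx & mx_le 0 (invmx A)].

Definition irreducible_mx A : Prop :=
  ~ exists S : {set 'I_n}, [/\ S != set0, S != setT &
      forall i j, i \in S -> j \notin S -> A i j = 0].

End Matrices.

Section NewtonNoda.
Variables (R : realType) (n : nat).
Variables (A : 'M[R]_n.+1) (a : 'cV[R]_n.+1) (Gamma : R).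
Implicit Types (u w Delta : 'cV[R]_n.+1) (lambda delta theta : R).

Definition calA u : 'M[R]_n.+1 :=
  A + Gamma *: diag (ones - vdiv ones (a + vpow u 2)).

Definition res u lambda : 'cV[R]_n.+1 := calA u *m u - lambda *: u.

Definition jac u lambda : 'M[R]_n.+1 :=
  A + (Gamma - lambda)%:M
  - Gamma *: diag (vdiv (a - vpow u 2) (vpow (a + vpow u 2) 2)).

Definition nodaval u : R := vmin (vdiv (calA u *m u) u).

Definition newton_system u lambda Delta delta : Prop :=
  block_mx (jac u lambda) (- u) (- u^T) 0 *m col_mx Delta delta%:M
  = - col_mx (res u lambda) (2^-1 *: (1%:M - u^T *m u)).

Definition wstep u Delta theta : 'cV[R]_n.+1 := u + theta *: Delta.

Definition normalize w : 'cV[R]_n.+1 := (norm2 w)^-1 *: w.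

Definition hstep u lambda Delta theta : 'cV[R]_n.+1 :=
  res (normalize (wstep u Delta theta)) lambda.

Definition Rstep u lambda Delta delta theta : 'cV[R]_n.+1 :=
  hstep u lambda Delta theta
  - ((1 - theta) / norm2 (wstep u Delta theta)) *: res u lambda
  - (theta * delta / norm2 (wstep u Delta theta)) *: u.

(* The bound is uniform in the positive unit vector, not only along a run. *)
Definition remainder_bound (M : R) : Prop :=
  forall u Delta delta theta,
    mx_lt 0 u -> norm2 u = 1 ->
    newton_system u (nodaval u) Delta delta ->
    0 < theta <= 1 ->
    norm2 (Rstep u (nodaval u) Delta delta theta)
      <= M * theta ^+ 2 * norm2 Delta ^+ 2.

Definition theta_rule (eta M : R) u lambda Delta delta : R :=
  let w1 := wstep u Delta 1 in
  if mx_le ((delta / ((1 + eta) * norm2 w1)) *: u) (hstep u lambda Delta 1)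
  then 1
  else eta * delta * vmin u / ((1 + eta) * M * norm2 w1 * norm2 Delta ^+ 2).

Record newton_noda (eta M : R) (u : nat -> 'cV[R]_n.+1) (lambda : nat -> R)
    (Delta : nat -> 'cV[R]_n.+1) (delta theta : nat -> R) : Prop := NewtonNoda {
  nn_init_gt0 : mx_lt 0 (u 0%N);
  nn_init_unit : norm2 (u 0%N) = 1;
  nn_lambda : forall k, lambda k = nodaval (u k);
  nn_system : forall k, newton_system (u k) (lambda k) (Delta k) (delta k);
  nn_theta_range : forall k, 0 < theta k <= 1;
  nn_theta : forall k,
    theta k = theta_rule eta M (u k) (lambda k) (Delta k) (delta k);
  nn_next : forall k, u k.+1 = normalize (wstep (u k) (Delta k) (theta k))
}.

End NewtonNoda.

(* Main.v *)
(** For a positive unit vector [u], let [lambda u] be the largest [lambda] with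
    [res u lambda >= 0], i.e. Noda's value [min (A(u) u / u)]. It tends to
    [-oo] at the boundary of the positive orthant, since [A] is an irreducible
    Z-matrix, so it has a maximiser [u]. If [r = res u (lambda u)] were nonzero,
    a Newton-Noda step would increase [lambda]: the Jacobian [J] is a Z-matrix
    with [J u > 0], hence has a nonnegative inverse, so that
    [J Delta = delta u - r] can be solved with [delta > 0 > u^T Delta]. Then
    [res (u + t Delta) = (1 - t) r + t delta u + O(t^2)] is positive for small
    [t > 0], and it remains so after normalisation because [|u + t Delta| <= 1]
    and the nonlinearity [1 - 1 / (a + s)] increases with [s]. Hence [r = 0];
    existence of the eigenvector thus needs no convergence of the iteration. *)

Require Import Defs.
From mathcomp Require Import all_boot all_order all_algebra.
From mathcomp Require Import ring.
From mathcomp Require Import all_classical.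
From mathcomp Require Import reals topology normedtype derive.

Set Implicit Arguments.
Unset Strict Implicit.
Unset Printing Implicit Defensive.

Import Order.TTheory GRing.Theory Num.Theory.
Import numFieldNormedType.Exports.
Local Open Scope classical_set_scope.
Local Open Scope ring_scope.

(** * Z-matrices that send some positive vector to a positive vector *)

Section Semipositive.
Variables (R : realType) (n : nat) (J : 'M[R]_n) (v : 'cV[R]_n).
Hypotheses (ZJ : Zmatrix J) (v_gt0 : forall i, 0 < v i 0)
  (Jv_gt0 : forall i, 0 < (J *m v) i 0).

(** At an index [i] minimising [q = x / v], row [i] of [J *m (x - q i *: v)] is a sum without
    positive terms, since [J] is a Z-matrix; [q i < 0] would make that sum positive. *)
Lemma Zmatrix_monotone (x : 'cV[R]_n) :
  (forall i, 0 <= (J *m x) i 0) -> forall i, 0 <= x i 0.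
Proof.
move=> Jx_ge0 i0.
pose q i := x i 0 / v i 0.
have [i _ qi_min] := @arg_minP _ _ _ i0 xpredT q isT.
have qx j : x j 0 = q j * v j 0 by rewrite /q divfK // gt_eqF.
have [qi_ge0|qi_lt0] := leP 0 (q i).
  by rewrite qx mulr_ge0 ?(ltW (v_gt0 _)) // (le_trans qi_ge0) ?qi_min.
have: 0 < (J *m x) i 0 - q i * (J *m v) i 0.
  by rewrite ltr_wpDl // oppr_gt0 nmulr_rlt0.
rewrite !mxE mulr_sumr -sumrB ltNge sumr_le0 // => j _.
rewrite mulrCA -mulrBr qx -mulrBl.
have [<-|neq_ij] := eqVneq i j; first by rewrite subrr mul0r mulr0.
by rewrite mulr_le0_ge0 ?ZJ // mulr_ge0 ?(ltW (v_gt0 _)) // subr_ge0 qi_min.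
Qed.

(** If [J *m y = 0], monotonicity applies to both [y] and [- y], so [y = 0]. The transposes appear
    because [kermx] is a left kernel. *)
Lemma Zmatrix_semipositive_unitmx : J \in unitmx.
Proof.
rewrite -unitmx_tr -row_free_unit; apply/row_freeP.
suff ker0 : kermx J^T = 0.
  apply/row_freeP; rewrite -kermx_eq0; exact/eqP.
apply/row_matrixP => i; rewrite row0; apply: trmx_inj; rewrite trmx0.
set y := (row i (kermx J^T))^T.
have Jy : J *m y = 0.
  apply: trmx_inj; rewrite trmx_mul trmxK trmx0 -row_mul mulmx_ker.
  by rewrite row0.
have y_ge0 := @Zmatrix_monotone y.
have y_le0 := @Zmatrix_monotone (- y).
apply/matrixP => j k; rewrite ord1 [RHS]mxE; apply/eqP; rewrite eq_le.
rewrite y_ge0 ?andbT; last by move=> l; rewrite Jy mxE.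
rewrite -oppr_ge0; have := y_le0 _ j; rewrite mulmxN Jy oppr0 [(- y) j 0]mxE.
by apply=> l; rewrite mxE.
Qed.

(** The solution is nonnegative by monotonicity and nonzero because [b] is, so positive weights give
    a positive sum. *)
Lemma dotmx_Zmatrix_solve_gt0 (b : 'cV[R]_n) :
  (forall i, 0 <= b i 0) -> b != 0 ->
  0 < \sum_i v i 0 * (invmx J *m b) i 0.
Proof.
move=> b_ge0 b_neq0; set z := invmx J *m b.
have Jz : J *m z = b by rewrite mulKVmx // Zmatrix_semipositive_unitmx.
have z_ge0 : forall i, 0 <= z i 0 by apply: Zmatrix_monotone; rewrite Jz.
have vz_ge0 i : 0 <= v i 0 * z i 0 by rewrite mulr_ge0 ?(ltW (v_gt0 _)).
rewrite lt_neqAle sumr_ge0 ?andbT //; apply: contra b_neq0 => /eqP/esym.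
move/psumr_eq0P => vz0; rewrite -Jz (_ : z = 0) ?mulmx0 //.
apply/matrixP => i j; rewrite ord1 [RHS]mxE.
apply/eqP; have /eqP := vz0 (fun i _ => vz_ge0 i) i isT.
by rewrite mulf_eq0 gt_eqF.
Qed.

End Semipositive.

(** * The residual, its Jacobian and an exact Taylor expansion *)

Section Nonlinearity.
Variables (R : realType) (n : nat).
Variables (A : 'M[R]_n.+1) (a : 'cV[R]_n.+1) (Gamma : R).
Implicit Types (u v w Delta : 'cV[R]_n.+1) (lambda : R).

Lemma resE u lambda i :
  res A a Gamma u lambda i 0 = \sum_j A i j * u j 0
    + Gamma * ((1 - (a i 0 + u i 0 ^+ 2)^-1) * u i 0) - lambda * u i 0.
Proof.
rewrite /res /calA mulmxDl -scalemxAl /diag mul_diag_mx.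
by rewrite !mxE div1r.
Qed.

Lemma jac_mulE u lambda Delta i :
  (jac A a Gamma u lambda *m Delta) i 0 = \sum_j A i j * Delta j 0
    + Gamma * ((1 - (a i 0 - u i 0 ^+ 2) / (a i 0 + u i 0 ^+ 2) ^+ 2)
        * Delta i 0) - lambda * Delta i 0.
Proof.
rewrite /jac mulmxBl mulmxDl -scalemxAl /diag mul_diag_mx mul_scalar_mx.
rewrite !mxE; ring.
Qed.

Hypotheses (ha : forall i, 0 < a i 0) (hGamma : 0 < Gamma).

Let den_gt0 i (x : R) : 0 < a i 0 + x ^+ 2.
Proof. by rewrite ltr_pwDl ?sqr_ge0. Qed.

(** Since [J u - r = 2 Gamma u^3 / (a + u^2)^2] entrywise, [u] itself is the positive vector that
    the Z-matrix lemmas ask for. *)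
Lemma jac_mul_gt0 u lambda : (forall i, 0 < u i 0) ->
  (forall i, 0 <= res A a Gamma u lambda i 0) ->
  forall i, 0 < (jac A a Gamma u lambda *m u) i 0.
Proof.
move=> u_gt0 r_ge0 i; have D := den_gt0 i (u i 0).
rewrite jac_mulE.
have -> : \sum_j A i j * u j 0
    + Gamma * ((1 - (a i 0 - u i 0 ^+ 2) / (a i 0 + u i 0 ^+ 2) ^+ 2) * u i 0)
    - lambda * u i 0
  = res A a Gamma u lambda i 0
    + Gamma * (2 * u i 0 ^+ 3 / (a i 0 + u i 0 ^+ 2) ^+ 2).
  by rewrite resE; field; rewrite gt_eqF.
by rewrite ltr_wpDl // mulr_gt0 // divr_gt0 ?exprn_gt0 // mulr_gt0 ?exprn_gt0.
Qed.

Lemma Zmatrix_jac u lambda : Zmatrix A -> Zmatrix (jac A a Gamma u lambda).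
Proof.
move=> ZA i j neq_ij; rewrite /jac /diag !mxE (negPf neq_ij) !mulr0n.
by rewrite mulr0 oppr0 !addr0 ZA.
Qed.

(** The second-order remainder of the residual, divided exactly by [theta ^+ 2]; for positive [a]
    this closed form is also continuous at [theta = 0]. *)
Definition taylor_rem u Delta theta i : R :=
  Gamma * (Delta i 0 ^+ 2
    * (a i 0 * (u i 0 + theta * Delta i 0) + 2 * a i 0 * u i 0
       - u i 0 ^+ 2 * (u i 0 + theta * Delta i 0))
    / ((a i 0 + (u i 0 + theta * Delta i 0) ^+ 2)
       * (a i 0 + u i 0 ^+ 2) ^+ 2)).

Lemma res_taylor u lambda Delta theta i :
  res A a Gamma (u + theta *: Delta) lambda i 0 = res A a Gamma u lambda i 0
    + theta * ((jac A a Gamma u lambda *m Delta) i 0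
               + theta * taylor_rem u Delta theta i).
Proof.
rewrite !resE jac_mulE /taylor_rem.
have -> : \sum_j A i j * (u + theta *: Delta) j 0
    = \sum_j A i j * u j 0 + theta * \sum_j A i j * Delta j 0.
  by rewrite mulr_sumr -big_split; apply: eq_bigr => j _ /=; rewrite !mxE; ring.
rewrite !mxE; have D0 := den_gt0 i (u i 0).
have D1 := den_gt0 i (u i 0 + theta * Delta i 0).
by field; rewrite !gt_eqF.
Qed.

Lemma continuous_taylor_rem u Delta i :
  continuous (fun theta => taylor_rem u Delta theta i).
Proof.
move=> t.
have cw : (fun theta => u i 0 + theta * Delta i 0) @ t -->
    u i 0 + t * Delta i 0.
  by apply: cvgD; [exact: cvg_cst|apply: cvgM; [exact: cvg_id|exact: cvg_cst]].
apply: cvgM; first exact: cvg_cst.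
apply: cvgM.
  apply: cvgM; first exact: cvg_cst.
  by apply: cvgB; [apply: cvgD; last exact: cvg_cst|];
    apply: cvgM => //; exact: cvg_cst.
apply: cvgV; first by rewrite mulf_neq0 ?expf_neq0 // gt_eqF.
apply: cvgM; last exact: cvg_cst.
by apply: cvgD; [exact: cvg_cst|rewrite expr2; apply: cvgM].
Qed.

(* [s |-> 1 - 1 / (a + s)] increases, so stretching [w] favours the residual. *)
Lemma res_scale_ge w lambda t i : 1 <= t -> 0 < w i 0 ->
  t * res A a Gamma w lambda i 0 <= res A a Gamma (t *: w) lambda i 0.
Proof.
move=> t_ge1 w_gt0; rewrite !resE.
have -> : \sum_j A i j * (t *: w) j 0 = t * \sum_j A i j * w j 0.
  by rewrite mulr_sumr; apply: eq_bigr => j _; rewrite mxE mulrCA.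
rewrite mxE -subr_ge0; set S := \sum_j _.
have -> : t * S + Gamma * ((1 - (a i 0 + (t * w i 0) ^+ 2)^-1) * (t * w i 0))
    - lambda * (t * w i 0)
    - t * (S + Gamma * ((1 - (a i 0 + w i 0 ^+ 2)^-1) * w i 0)
           - lambda * w i 0)
  = Gamma * (t * w i 0)
    * ((a i 0 + w i 0 ^+ 2)^-1 - (a i 0 + (t * w i 0) ^+ 2)^-1) by ring.
have t_gt0 := lt_le_trans ltr01 t_ge1.
rewrite mulr_ge0 ?mulr_ge0 ?(ltW t_gt0) ?(ltW w_gt0) ?(ltW hGamma) //.
rewrite subr_ge0 lef_pV2 ?posrE ?den_gt0 // lerD2l exprMn.
by rewrite ler_peMl ?sqr_ge0 // exprn_ege1.
Qed.

End Nonlinearity.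

(** * Small positive parameters and closed sets *)

Lemma near_right0_perturb_gt0 (R : realType) (b : R) (f : R -> R) :
  0 < b -> {for 0, continuous f} ->
  \forall t \near 0^'+, 0 < b + t * f t.
Proof.
move=> b_gt0 cf; have cbf : (fun t => b + t * f t) @ 0^'+ --> b + 0 * f 0.
  apply: cvg_at_right_filter.
  by apply: cvgD; [exact: cvg_cst|apply: cvgM; [exact: cvg_id|exact: cf]].
by apply: (cvgr_gt _ cbf); rewrite mul0r addr0.
Qed.

Lemma closed_ge_fun (R : realType) (T : topologicalType) (f : T -> R) (y : R) :
  continuous f -> closed [set x | y <= f x].
Proof.
by move=> cf; apply: (preimage_closed _ (@closed_ge R y)) => x _; exact: cf.
Qed.

(** * The ascent step, compactness and the maximiser *)

Section Existence.
Variables (R : realType) (n : nat).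
Variables (A : 'M[R]_n.+1) (a : 'cV[R]_n.+1) (Gamma : R).
Implicit Types (u v w Delta : 'cV[R]_n.+1) (lambda mu delta : R).
Hypotheses (ha : forall i, 0 < a i 0) (hGamma : 0 < Gamma) (ZA : Zmatrix A).

Lemma Noda_ascent_direction u lambda : (forall i, 0 < u i 0) ->
  (forall i, 0 <= res A a Gamma u lambda i 0) -> res A a Gamma u lambda != 0 ->
  exists Delta delta, [/\ 0 < delta,
    jac A a Gamma u lambda *m Delta = delta *: u - res A a Gamma u lambda
    & \sum_i u i 0 * Delta i 0 < 0].
Proof.
move=> u_gt0 r_ge0 r_neq0; set r := res _ _ _ _ _; set J := jac _ _ _ _ _.
have ZJ : Zmatrix J by exact: Zmatrix_jac.
have Ju_gt0 : forall i, 0 < (J *m u) i 0 by exact: jac_mul_gt0.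
have J_unit := @Zmatrix_semipositive_unitmx _ _ _ _ ZJ u_gt0 Ju_gt0.
have solve_gt0 := @dotmx_Zmatrix_solve_gt0 _ _ _ _ ZJ u_gt0 Ju_gt0.
have uz_gt0 := solve_gt0 _ r_ge0 r_neq0.
have u_neq0 : u != 0.
  by apply: contraTneq (u_gt0 0) => ->; rewrite mxE ltxx.
have uy_gt0 := solve_gt0 _ (fun i => ltW (u_gt0 i)) u_neq0.
set z := invmx J *m r in uz_gt0; set y := invmx J *m u in uy_gt0.
set uz := \sum_i _ in uz_gt0; set uy := \sum_i _ in uy_gt0.
(* At a unit vector the Newton step has [delta = uz / uy], which makes [Delta] orthogonal to [u];
   halving it makes the inner product [- (uz / 2)]. *)
exists ((uz / uy / 2) *: y - z), (uz / uy / 2); split.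
- by rewrite !divr_gt0.
- by rewrite mulmxBr -scalemxAr !mulKVmx.
- have -> : \sum_i u i 0 * ((uz / uy / 2) *: y - z) i 0 = uz / uy / 2 * uy - uz.
    rewrite mulr_sumr -sumrB; apply: eq_bigr => i _; rewrite !mxE; ring.
  have -> : uz / uy / 2 * uy - uz = - (uz / 2) by field; rewrite gt_eqF.
  by rewrite oppr_lt0 divr_gt0.
Qed.

Lemma Noda_improvement u lambda : (forall i, 0 < u i 0) ->
  \sum_i u i 0 ^+ 2 = 1 ->
  (forall i, 0 <= res A a Gamma u lambda i 0) -> res A a Gamma u lambda != 0 ->
  exists v mu, [/\ lambda < mu, forall i, 0 < v i 0, \sum_i v i 0 ^+ 2 = 1
    & forall i, 0 <= res A a Gamma v mu i 0].
Proof.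
move=> u_gt0 u1 r_ge0 r_neq0.
have [D [delta [delta_gt0 JD uD_lt0]]] :=
  Noda_ascent_direction u_gt0 r_ge0 r_neq0.
have [theta [th_gt0 th_lt1 w_gt0 w_le1 rw_gt0]] : exists theta, [/\
    0 < theta, theta < 1, forall i, 0 < (u + theta *: D) i 0,
    \sum_i (u + theta *: D) i 0 ^+ 2 <= 1
    & forall i, 0 < res A a Gamma (u + theta *: D) lambda i 0].
  suff: \forall theta \near (0 : R)^'+, [/\
      0 < theta, theta < 1, forall i, 0 < (u + theta *: D) i 0,
      \sum_i (u + theta *: D) i 0 ^+ 2 <= 1
      & forall i, 0 < res A a Gamma (u + theta *: D) lambda i 0].
    by move/filter_ex.
  have w_near : \forall t \near (0 : R)^'+, forall i, 0 < u i 0 + t * D i 0.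
    apply: filter_forall => i.
    by apply: (@near_right0_perturb_gt0 _ _ (fun=> _)) => //; exact: cvg_cst.
  (* The squared norm of [u + t D] is 1 minus [t] times this expression, so its positivity keeps the
     norm at most 1. *)
  have nw_near : \forall t \near (0 : R)^'+,
      0 < - 2 * (\sum_i u i 0 * D i 0) + t * - \sum_i D i 0 ^+ 2.
    apply: (@near_right0_perturb_gt0 _ _ (fun=> _)); last exact: cvg_cst.
    by rewrite mulNr oppr_gt0 pmulr_rlt0.
  have rw_near : \forall t \near (0 : R)^'+,
      forall i, 0 < delta * u i 0 + t * taylor_rem a Gamma u D t i.
    apply: filter_forall => i.
    apply: near_right0_perturb_gt0; first by rewrite mulr_gt0.
    exact: continuous_taylor_rem.
  have JDi i : (jac A a Gamma u lambda *m D) i 0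
      = delta * u i 0 - res A a Gamma u lambda i 0 by rewrite JD !mxE.
  near=> t.
  have t_gt0 : 0 < t by near: t; exact: nbhs_right_gt.
  have t_lt1 : t < 1 by near: t; exact: nbhs_right_lt.
  split=> // [i||i].
  - by rewrite !mxE; move: i; near: t.
  - have -> : \sum_i (u + t *: D) i 0 ^+ 2
      = 1 - t * (- 2 * (\sum_i u i 0 * D i 0) + t * - \sum_i D i 0 ^+ 2).
      rewrite [RHS](_ : _ = \sum_i u i 0 ^+ 2
        + t * 2 * (\sum_i u i 0 * D i 0) + t ^+ 2 * \sum_i D i 0 ^+ 2);
        last by rewrite u1; ring.
      rewrite !mulr_sumr -!big_split.
      by apply: eq_bigr => i _ /=; rewrite !mxE; ring.
    rewrite gerBl mulr_ge0 ?(ltW t_gt0) // ltW //; near: t; exact: nw_near.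
  - rewrite (res_taylor _ _ ha) JDi.
    set r := res _ _ _ _ _; set T := taylor_rem _ _ _ _ _ _.
    rewrite [X in 0 < X](_ : _ = (1 - t) * r i 0 + t * (delta * u i 0 + t * T));
      last by ring.
    rewrite ltr_wpDl ?mulr_ge0 ?r_ge0 ?subr_ge0 ?(ltW t_lt1) // mulr_gt0 //.
    by rewrite /T; move: i @T; near: t.
set w := u + theta *: D in w_gt0 w_le1 rw_gt0.
set N := \sum_i w i 0 ^+ 2 in w_le1.
have N_gt0 : 0 < N.
  rewrite /N big_ord_recl ltr_pwDl ?exprn_gt0 // sumr_ge0 // => i _.
  exact: sqr_ge0.
(* As [N <= 1], normalising stretches [w], which keeps its residual positive. *)
pose s := (Num.sqrt N)^-1.
have s_ge1 : 1 <= s by rewrite invf_ge1 ?sqrtr_gt0 // -sqrtr1 ler_wsqrtr.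
have s_gt0 := lt_le_trans ltr01 s_ge1.
have v_gt0 i : 0 < (s *: w) i 0 by rewrite mxE mulr_gt0.
have rv_gt0 i : 0 < res A a Gamma (s *: w) lambda i 0.
  by apply: lt_le_trans (res_scale_ge _ ha hGamma _ _ _);
    rewrite ?mulr_gt0.
(* The residual is strictly positive in finitely many rows, which leaves room to raise [lambda] by
   some [e]. *)
have [e [e_gt0 he]] : exists e, 0 < e /\
    forall i, 0 <= res A a Gamma (s *: w) lambda i 0 - e * (s *: w) i 0.
  suff: \forall e \near (0 : R)^'+, 0 < e /\
      forall i, 0 <= res A a Gamma (s *: w) lambda i 0 - e * (s *: w) i 0.
    by move/filter_ex.
  have e_near : \forall e \near (0 : R)^'+,
      forall i, 0 < res A a Gamma (s *: w) lambda i 0 + e * - (s *: w) i 0.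
    apply: filter_forall => i.
    by apply: (@near_right0_perturb_gt0 _ _ (fun=> _)) => //; exact: cvg_cst.
  near=> e; split; first by near: e; exact: nbhs_right_gt.
  by move=> i; rewrite -mulrN ltW //; move: i; near: e.
exists (s *: w), (lambda + e); split=> //.
- by rewrite ltrDl.
- under eq_bigr do rewrite mxE exprMn.
  by rewrite -mulr_sumr exprVn sqr_sqrtr ?(ltW N_gt0) // mulVf ?gt_eqF.
- by move=> i; have := he i; rewrite !resE [(lambda + e) * _]mulrDl opprD addrA.
Unshelve. all: by end_near.
Qed.

(** In a row where [u] vanishes the residual is a sum of nonpositive terms [A i j * u j], so each is
    zero and the zero set of [u] would contradict irreducibility. This excludes a maximiser on the
    boundary of the orthant. *)
Lemma res_ge0_gt0 u lambda : irreducible_mx A -> u != 0 ->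
  (forall i, 0 <= u i 0) -> (forall i, 0 <= res A a Gamma u lambda i 0) ->
  forall i, 0 < u i 0.
Proof.
move=> irrA u_neq0 u_ge0 r_ge0 i0; rewrite lt_neqAle u_ge0 andbT eq_sym.
apply/negP => ui0_eq0; apply: irrA; exists [set i | u i 0 == 0]%SET; split.
- by apply/set0Pn; exists i0; rewrite inE.
- apply: contra u_neq0 => /eqP/setP Z; apply/eqP/matrixP => i j.
  by rewrite ord1 mxE; have := Z i; rewrite !inE => /eqP.
move=> i j; rewrite !inE => /eqP ui0 uj_neq0.
have := r_ge0 i; rewrite resE ui0 !mulr0 addr0 subr0 => S_ge0.
have Au_le0 k : A i k * u k 0 <= 0.
  have [<-|neq_ik] := eqVneq i k; first by rewrite ui0 mulr0.
  by rewrite mulr_le0_ge0 ?ZA.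
have S_eq0 : \sum_k - (A i k * u k 0) = 0.
  apply/eqP; rewrite sumrN eq_le oppr_le0 S_ge0 oppr_ge0.
  by rewrite sumr_le0.
have NAu_ge0 k : true -> 0 <= - (A i k * u k 0) by rewrite oppr_ge0.
have /(_ j isT)/eqP := psumr_eq0P NAu_ge0 S_eq0.
by rewrite oppr_eq0 mulf_eq0 (negPf uj_neq0) orbF => /eqP.
Qed.

(** In a row with [u i > 0] the off-diagonal terms are nonpositive and the nonlinear factor is at
    most 1, so [lambda <= A i i + Gamma]; summing absolute values removes the dependence on [i]. *)
Lemma res_ge0_lambda_le u lambda : u != 0 ->
  (forall i, 0 <= u i 0) -> (forall i, 0 <= res A a Gamma u lambda i 0) ->
  lambda <= \sum_i `|A i i| + Gamma.
Proof.
move=> u_neq0 u_ge0 r_ge0.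
have /existsP [i ui_neq0] : [exists i, u i 0 != 0].
  apply: contraR u_neq0 => /existsPn uz; apply/eqP/matrixP => i j.
  by rewrite ord1 mxE; have := uz i; rewrite negbK => /eqP.
have ui_gt0 : 0 < u i 0 by rewrite lt_neqAle u_ge0 eq_sym ui_neq0.
rewrite -(ler_pM2r ui_gt0) -subr_ge0; apply: le_trans (r_ge0 i) _.
rewrite resE lerD2r [leRHS]mulrDl; apply: lerD.
  rewrite (bigD1 i) //= -[leRHS]addr0; apply: lerD.
    rewrite ler_wpM2r // (bigD1 i) //= ler_wpDr ?ler_norm //.
    by apply: sumr_ge0 => j _.
  by apply: sumr_le0 => j neq_ji; rewrite mulr_le0_ge0 ?ZA // eq_sym.
rewrite mulrA ler_wpM2r // ler_piMr ?(ltW hGamma) // gerBl invr_ge0.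
by rewrite addr_ge0 ?sqr_ge0 // ltW.
Qed.

(** Stated on row vectors, the form in which [rV_compact] supplies a compact cube. *)
Lemma continuous_res i :
  continuous (fun p : 'rV[R]_n.+1 * R => res A a Gamma p.1^T p.2 i 0).
Proof.
move=> p.
have cc j : (fun q : 'rV[R]_n.+1 * R => q.1 0 j) @ p --> p.1 0 j.
  apply: (@continuous_comp _ _ _ fst (fun x : 'rV[R]_n.+1 => x 0 j));
    [exact: cvg_fst|exact: coord_continuous].
have cs : (fun q : 'rV[R]_n.+1 * R => q.2) @ p --> p.2 by exact: cvg_snd.
have E q : res A a Gamma q.1^T q.2 i 0 = \sum_j A i j * q.1 0 j
    + Gamma * ((1 - (a i 0 + q.1 0 i ^+ 2)^-1) * q.1 0 i) - q.2 * q.1 0 i.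
  by rewrite resE !mxE; under eq_bigr do rewrite mxE.
rewrite (funext E : (fun q => _) = _).
apply: cvgB; last exact: cvgM.
apply: cvgD.
  apply: cvg_big => [|j _]; first exact: add_continuous.
  by apply: cvgM; first exact: cvg_cst.
apply: cvgM; first exact: cvg_cst.
apply: cvgM => //; apply: cvgB; first exact: cvg_cst.
apply: cvgV; first by rewrite gt_eqF // ltr_pwDl ?sqr_ge0.
by apply: cvgD; [exact: cvg_cst|rewrite expr2; apply: cvgM].
Qed.

(* Maximising [lambda] over the pairs [(u, lambda)] with [res u lambda >= 0]
   avoids the continuity of a minimum of quotients. *)
Lemma Noda_maximizer v0 mu0 : irreducible_mx A ->
  (forall i, 0 < v0 i 0) -> \sum_i v0 i 0 ^+ 2 = 1 ->
  (forall i, 0 <= res A a Gamma v0 mu0 i 0) ->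
  exists u lambda, [/\ forall i, 0 < u i 0, \sum_i u i 0 ^+ 2 = 1,
    forall i, 0 <= res A a Gamma u lambda i 0
    & forall v mu, (forall i, 0 < v i 0) -> \sum_i v i 0 ^+ 2 = 1 ->
        (forall i, 0 <= res A a Gamma v mu i 0) -> mu <= lambda].
Proof.
move=> irrA v0_gt0 v0_1 r0_ge0.
have unit_neq0 (v : 'cV[R]_n.+1) : \sum_i v i 0 ^+ 2 = 1 -> v != 0.
  move=> v1; apply: contra_eq_neq v1 => ->.
  rewrite big1 => [|i _]; last by rewrite mxE expr0n.
  by rewrite eq_sym oner_neq0.
pose C : R := \sum_i `|A i i| + Gamma.
pose box := [set x : 'rV[R]_n.+1 | forall i, `[0, 1]%classic (x ord0 i)]
  `*` `[mu0, C]%classic.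
pose K := box
  `&` ([set p : 'rV[R]_n.+1 * R | forall i, 0 <= res A a Gamma p.1^T p.2 i 0]
  `&` [set p : 'rV[R]_n.+1 * R | \sum_i p.1 0 i ^+ 2 = 1]).
have K_in (v : 'cV[R]_n.+1) mu :
    (forall i, 0 < v i 0) -> \sum_i v i 0 ^+ 2 = 1 ->
    (forall i, 0 <= res A a Gamma v mu i 0) -> mu0 <= mu ->
    K (v^T, mu).
  move=> v_gt0 v1 r_ge0 mu0_le; split; split=> /=.
  - move=> i; rewrite /= mxE in_itv /= ltW //=.
    rewrite -(@expr_le1 _ 2) //; last exact: ltW.
    rewrite -v1 (bigD1 i) //= lerDl sumr_ge0 // => j _; exact: sqr_ge0.
  - rewrite in_itv /= mu0_le /=.
    by apply: res_ge0_lambda_le r_ge0 => [|i]; [exact: unit_neq0|exact: ltW].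
  - by rewrite trmxK.
  - by rewrite -v1; apply: eq_bigr => i _; rewrite mxE.
have Kv0 : K (v0^T, mu0) by exact: K_in.
have cptK : compact K.
  apply: compact_closedI.
    apply: compact_setX; last exact: segment_compact.
    by apply: (@rV_compact R _ (fun=> `[0, 1]%classic)) => i;
      exact: segment_compact.
  apply: closedI.
    rewrite (_ : mkset _
      = \bigcap_i [set p | 0 <= res A a Gamma p.1^T p.2 i 0]).
      by apply: closed_bigI => i _; apply: closed_ge_fun; exact: continuous_res.
    by apply/seteqP; split=> p /= r_ge0 i; [move=> _|]; exact: r_ge0.
  apply: (preimage_closed _ (@closed_eq R 1)) => p _.
  apply: cvg_big => [|j _]; first exact: add_continuous.
  have cj : (fun q : 'rV[R]_n.+1 * R => q.1 0 j) @ p --> p.1 0 j.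
    apply: (@continuous_comp _ _ _ fst (fun x : 'rV[R]_n.+1 => x 0 j));
      [exact: cvg_fst|exact: coord_continuous].
  by rewrite expr2; apply: cvgM.
have [[x lambda]] := @compact_EVT_max _ R snd K (ex_intro _ _ Kv0) cptK
  (continuous_subspaceT (fun=> cvg_snd)).
rewrite inE => -[[/= x_box lambda_box] [/= r_ge0 x1]] lambda_max.
have xT1 : \sum_i x^T i 0 ^+ 2 = 1.
  by rewrite -x1; apply: eq_bigr => i _; rewrite mxE.
exists x^T, lambda; split=> //.
- apply: res_ge0_gt0 r_ge0 => // [|i]; first exact: unit_neq0.
  by rewrite mxE; have := x_box i; rewrite /= in_itv /= => /andP[].
- move=> v mu v_gt0 v1 rv_ge0; have [mu0_le|/ltW mu_le] := leP mu0 mu.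
    by have := lambda_max (v^T, mu); apply; rewrite inE; exact: K_in.
  apply: le_trans mu_le _.
  by have := lambda_max (v0^T, mu0); apply; rewrite inE.
Qed.

(** Shows that the maximisation is over a nonempty set. For a constant unit vector, [mu0] is so low
    that [- mu0 * c] is the sum of all [|res v0 0|], which outweighs each entry. *)
Lemma exists_positive_unit_res_ge0 : exists v0 mu0,
  [/\ forall i, 0 < v0 i 0, \sum_i v0 i 0 ^+ 2 = 1
    & forall i, 0 <= res A a Gamma v0 mu0 i 0].
Proof.
pose c : R := (Num.sqrt n.+1%:R)^-1.
have c_gt0 : 0 < c by rewrite invr_gt0 sqrtr_gt0.
pose v0 : 'cV[R]_n.+1 := const_mx c.
exists v0, (- (\sum_i `|res A a Gamma v0 0 i 0|) / c); split=> [i||i].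
- by rewrite mxE.
- under eq_bigr do rewrite mxE.
  rewrite sumr_const card_ord exprVn sqr_sqrtr ?ler0n //.
  by rewrite -[LHS]mulr_natl divff ?pnatr_eq0.
- have -> : res A a Gamma v0 (- (\sum_i `|res A a Gamma v0 0 i 0|) / c) i 0
      = res A a Gamma v0 0 i 0 + \sum_i `|res A a Gamma v0 0 i 0|.
    rewrite [LHS]resE [X in _ = X + _]resE [v0 i 0]mxE divfK ?gt_eqF //.
    by rewrite mul0r subr0 opprK.
  rewrite (bigD1 i) //= addrA addr_ge0 ?sumr_ge0 //.
  by rewrite -lerBlDr sub0r lerNl -normrN ler_norm.
Qed.

End Existence.

Theorem theorem4p1 (R : realType) (n : nat)
    (A : 'M[R]_n.+1) (a : 'cV[R]_n.+1) (Gamma : R)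
    (hA : nonsingular_Mmatrix A) (hAirr : irreducible_mx A)
    (eta M : R) (heta : 0 < eta) (hM : 0 < M)
    (hbound : remainder_bound A a Gamma M)
    (u : nat -> 'cV[R]_n.+1) (lambda : nat -> R)
    (Delta : nat -> 'cV[R]_n.+1) (delta theta : nat -> R)
    (hNN : newton_noda A a Gamma eta M u lambda Delta delta theta)
    (ha : mx_lt 0 a) (hGamma : 0 < Gamma) :
  exists (mu : R) (v : 'cV[R]_n.+1),
    [/\ mx_lt 0 v,
        A *m v + Gamma *: (diag (ones - vdiv ones (a + vpow v 2)) *m v)
          = mu *: v
      & v^T *m v = 1%:M].
Proof.
have [ZA _ _] := hA.
have a_gt0 i : 0 < a i 0.
  by have /forallP/(_ i)/forallP/(_ 0) := ha; rewrite mxE.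
have [v0 [mu0 [v0_gt0 v0_1 r0_ge0]]] := exists_positive_unit_res_ge0 A a Gamma.
have [v [mu [v_gt0 v1 r_ge0 mu_max]]] :=
  Noda_maximizer a_gt0 hGamma ZA hAirr v0_gt0 v0_1 r0_ge0.
(* A nonzero residual would allow a strictly larger [mu], against maximality. *)
have [r_eq0|r_neq0] := eqVneq (res A a Gamma v mu) 0; last first.
  have [w [mu' [lt_mu w_gt0 w1 rw_ge0]]] :=
    Noda_improvement a_gt0 hGamma ZA v_gt0 v1 r_ge0 r_neq0.
  by have := mu_max _ _ w_gt0 w1 rw_ge0; rewrite leNgt lt_mu.
exists mu, v; split.
- by apply/forallP => i; apply/forallP => j; rewrite ord1 mxE.
- apply/eqP; rewrite -subr_eq0 -r_eq0 /res /calA mulmxDl -scalemxAl; exact/eqP.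
- apply/matrixP => i j; rewrite !ord1 !mxE -[RHS]v1.
  by apply: eq_bigr => k _; rewrite mxE expr2.
Qed.
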